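(* Let $X$ be a complex Banach space, let $T \in L(X)$ and let $\Phi=(\Phi_1,\Phi_2)$ be a spectral partitioning function for $T$. If $\Psi=(\Psi_1,\Psi_2)$ is a spectral valued function such that $\Psi \leq \Phi$, then $\Psi$ is a spectral a-partitioning function for $T$ if and only if $\Phi_2(T) \setminus \Psi_2(T) = (\Psi_1(T) \setminus \Phi_1(T)) \bigsqcup (\sigma(T)\setminus \sigma_a(T))$.
   Context: $L(X)$ is the Banach algebra of bounded linear operators on $X$; $\sigma(T)$ is the spectrum and $\sigma_a(T)$ the approximate point spectrum of $T$; $\mathcal{P}(\mathbb{C})$ is the set of all subsets of $\mathbb{C}$. The symbol $\bigsqcup$ denotes disjoint union: $A = B \bigsqcup C$ means $A = B\cup C$ and $B\cap C=\emptyset$. A spectral valued function is a function $\Phi=(\Phi_1,\Phi_2): L(X)\to \mathcal{P}(\mathbb{C})\times\mathcal{P}(\mathbb{C})$ such that for every $S\in L(X)$, $\Phi_1(S)\subset\sigma(S)$ and $\Phi_2(S)\subset\sigma(S)$. A spectral valued function $\Phi$ is a spectral partitioning function for $T\in L(X)$ if $\sigma(T)=\Phi_1(T)\bigsqcup\Phi_2(T)$, and a spectral a-partitioning function for $T$ if $\sigma_a(T)=\Phi_1(T)\bigsqcup\Phi_2(T)$. For spectral valued functions $\Psi,\Phi$, write $\Psi\leq\Phi$ if for all $S\in L(X)$, $\Phi_1(S)\subset\Psi_1(S)$ and $\Psi_2(S)\subset\Phi_2(S)$. *)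

(* Defs.v *)
From HB Require Import structures.
From mathcomp Require Import all_boot all_order all_algebra complex.
From mathcomp Require Import all_classical all_reals all_analysis.

Set Implicit Arguments.
Unset Strict Implicit.
Unset Printing Implicit Defensive.

Import Order.TTheory GRing.Theory Num.Theory.
Import numFieldNormedType.Exports.

Local Open Scope classical_set_scope.
Local Open Scope ring_scope.

(* The norm of [X] takes its values in [R[i]], where [a <= b] means that [b - a]
   is a nonnegative real; hence, unless [X] is trivial, any such [M] is a
   nonnegative real. *)
Record bounded_operator (R : realType) (X : completeNormedModType R[i]) :=
  BoundedOperator {
    bounded_operator_linear :> {linear X -> X};
    bounded_operatorP :
      exists M : R[i], forall x : X,
        `|bounded_operator_linear x| <= M * `|x| }.

Section Spectrum.
Context {R : realType} {X : completeNormedModType R[i]}.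
Implicit Types (T S : bounded_operator X) (l : R[i]).

(* This is [l I - T]. *)
Definition shifted_operator T l : X -> X := fun x => l *: x - T x.

(* Invertibility is taken in the algebra of bounded operators, so the inverse is
   required to be bounded. *)
Definition spectrum T : set R[i] :=
  [set l | ~ exists S, cancel (shifted_operator T l) S /\
                       cancel S (shifted_operator T l)].

(* The scalars for which [l I - T] has a sequence of approximate eigenvectors,
   i.e., fails to be bounded below. *)
Definition approximate_point_spectrum T : set R[i] :=
  [set l | exists x : nat -> X,
     (forall n, `|x n| = 1) /\ shifted_operator T l (x n) @[n --> \oo] --> (0 : X)].

Definition is_disjoint_union (A B C : set R[i]) : Prop :=
  A = B `|` C /\ B `&` C = set0.

Record spectral_valued_function := SpectralValuedFunction {
  spectral_sets :> bounded_operator X -> set R[i] * set R[i];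
  spectral_sets1_sub : forall S, (spectral_sets S).1 `<=` spectrum S;
  spectral_sets2_sub : forall S, (spectral_sets S).2 `<=` spectrum S }.

Implicit Types Phi Psi : spectral_valued_function.

Definition spectral_partitioning Phi T : Prop :=
  is_disjoint_union (spectrum T) (Phi T).1 (Phi T).2.

Definition spectral_a_partitioning Phi T : Prop :=
  is_disjoint_union (approximate_point_spectrum T) (Phi T).1 (Phi T).2.

(* The order is reversed on the first component. *)
Definition spectral_le Psi Phi : Prop :=
  forall S, (Phi S).1 `<=` (Psi S).1 /\ (Psi S).2 `<=` (Phi S).2.

End Spectrum.

Arguments spectral_valued_function {R} X.

(* Main.v *)
Require Import Defs.
From mathcomp Require Import all_boot all_order all_algebra complex.
From mathcomp Require Import all_classical all_reals all_analysis.

Import Order.TTheory GRing.Theory Num.Theory.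
Import numFieldNormedType.Exports.

Local Open Scope classical_set_scope.
Local Open Scope ring_scope.

(** The only analytic fact needed is that the approximate point spectrum lies in the spectrum. The
    rest is set algebra at [T]: the order gives [F1 ⊆ P1] and [P2 ⊆ F2], so passing from [Phi] to
    [Psi] removes [F2 \ P2] from the second part. To partition [a] instead of [s = F1 ⊔ F2], each
    removed point must either move to the first part or leave [a], and not both. *)

(* A bounded inverse of [l I - T] would send approximate eigenvectors, which
   [l I - T] maps to a null sequence, to a null sequence as well. *)
Lemma approximate_point_spectrum_sub_spectrum (R : realType)
    (X : completeNormedModType R[i]) (T : bounded_operator X) :
  approximate_point_spectrum T `<=` spectrum T.
Proof.
move=> l [x [x1 Tx0]] [S [TK _]].
have [M SM] := bounded_operatorP S.
have Mx n : 1 <= `|M| * `|shifted_operator T l (x n)|.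
  have := SM (shifted_operator T l (x n)).
  rewrite TK x1 => le1; apply: (le_trans le1).
  (* [M] is only a scalar of [R[i]], but the bound dominates 1, so it is a nonnegative real and
     equals its own norm. *)
  rewrite -(ger0_norm (le_trans ler01 le1)) normrM normr_id.
  exact: lexx.
(* Adding 1 allows [M = 0] and turns the final estimate into the absurd [|M| + 1 <= |M|]. *)
have M1 : 0 < `|M| + 1 by rewrite ltr_wpDl.
have e0 : 0 < (`|M| + 1)^-1 by rewrite invr_gt0.
have [N _ /(_ N (leqnn N)) /= small] := cvgr0_norm_lt _ Tx0 _ e0.
have := le_trans (Mx N) (ler_wpM2l (normr_ge0 M) (ltW small)).
by rewrite ler_pdivlMr// mul1r gerDl ler10.
Qed.

Theorem theorem4p1 (R : realType) (X : completeNormedModType R[i])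
    (T : bounded_operator X) (Phi : spectral_valued_function X)
    (hPhi : spectral_partitioning Phi T)
    (Psi : spectral_valued_function X) (hle : spectral_le Psi Phi) :
  spectral_a_partitioning Psi T <->
  is_disjoint_union ((Phi T).2 `\` (Psi T).2)
    ((Psi T).1 `\` (Phi T).1)
    (spectrum T `\` approximate_point_spectrum T).
Proof.
have [F1P1 P2F2] := hle T.
have P1s := @spectral_sets1_sub _ _ Psi T.
have as_s := @approximate_point_spectrum_sub_spectrum _ _ T.
move: hPhi; rewrite /spectral_a_partitioning /spectral_partitioning.
(* From here on, only inclusions between subsets of the plane matter. *)
move: (Phi T) (Psi T) (spectrum T) (approximate_point_spectrum T)
  F1P1 P2F2 P1s as_s => [F1 F2] [P1 P2] s a /= F1P1 P2F2 P1s as_s.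
move=> [sE /disjoints_subset F12].
have F1s : F1 `<=` s by rewrite sE; left.
have F2s : F2 `<=` s by rewrite sE; right.
have sF z : s z -> F1 z \/ F2 z by rewrite sE.
split=> [[aE /disjoints_subset P12]|[DE /disjoints_subset D]].
  have P1a : P1 `<=` a by rewrite aE; left.
  have P2a : P2 `<=` a by rewrite aE; right.
  have aP z : a z -> P1 z \/ P2 z by rewrite aE.
  split; last by apply/disjoints_subset => z [/P1a az _] [].
  apply/seteqP; split=> z.
    move=> [F2z nP2z]; have [/aP [P1z|//]|naz] := pselect (a z).
      by left; split=> // /F12.
    by right; split=> //; exact: F2s.
  move=> [[P1z nF1z]|[sz naz]].
    split; last exact: P12.
    by have [] := sF z (P1s z P1z).
  by split; [have [/F1P1/P1a|] := sF z sz|move=> /P2a].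
have DF z : s z -> ~ a z -> F2 z /\ ~ P2 z.
  move=> sz naz; have : (P1 `\` F1 `|` s `\` a) z by right.
  by rewrite -DE.
have PF z : P1 z -> ~ F1 z -> F2 z /\ ~ P2 z.
  move=> P1z nF1z; have : (P1 `\` F1 `|` s `\` a) z by left.
  by rewrite -DE.
split; last first.
  (* A common point lies in [F2], hence outside [F1], so it is in [P1 \ F1] and therefore avoids
     [P2]. *)
  apply/disjoints_subset => z P1z P2z.
  by have [_] := PF z P1z (fun F1z => F12 z F1z (P2F2 z P2z)).
apply/seteqP; split=> z.
  move=> az; have [/F1P1|F2z] := sF z (as_s z az); first by left.
  have [P2z|nP2z] := pselect (P2 z); first by right.
  have : (F2 `\` P2) z by [].
  by rewrite DE => -[[]|[]]; [left|].
move=> [P1z|P2z]; apply: contrapT => naz.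
  have [F2z _] := DF z (P1s z P1z) naz.
  (* A point of [P1] outside [a] would lie in both [P1 \ F1] and [s \ a], which are disjoint. *)
  by apply: (D z); split; [|move=> /F12|exact: P1s|].
by have [_] := DF z (F2s z (P2F2 z P2z)) naz.
Qed.
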